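(* There is an absolute constant $c>0$ such that for every integer $k\ge 1$ there exists an election $(V,C,\succ_V)$, with at least $k$ candidates, such that for every set $S\subseteq C$ of $k$ candidates there exists a candidate $a\in C\setminus S$ such that for all $b\in S$, $$\tfrac1n|a\succ b|\ \ge\ \frac12+\frac{c}{k}.$$
   Context: An election is a tuple $(V,C,\succ_V)$, where $V$ is a finite nonempty set of $n$ voters, $C$ is a finite nonempty set of candidates, and $\succ_V=\{\succ_v\}_{v\in V}$ assigns to each voter $v$ a strict linear order $\succ_v$ on $C$; $a\succ_v b$ means that voter $v$ prefers candidate $a$ to candidate $b$. For $a,b\in C$, $$\tfrac1n|a\succ b| := \frac1n\sum_{v\in V}\mathds{1}[a\succ_v b]$$ is the fraction of voters that prefer $a$ over $b$. *)

(* Defs.v *)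
From HB Require Import structures.
From mathcomp Require Import all_boot all_order all_algebra.
From mathcomp Require Import reals.
Set Implicit Arguments.
Unset Strict Implicit.
Unset Printing Implicit Defensive.
Import Order.TTheory GRing.Theory Num.Theory.
Local Open Scope ring_scope.

(* [prefers v a b] reads: voter v strictly prefers a to b. *)
Record election := Election {
  voter : finType;
  candidate : finType;
  prefers : voter -> rel candidate;
  voter_gt0 : (0 < #|voter|)%N;
  candidate_gt0 : (0 < #|candidate|)%N;
  prefers_irr : forall v, irreflexive (prefers v);
  prefers_trans : forall v, transitive (prefers v);
  prefers_total : forall v a b, a != b -> prefers v a b || prefers v b a
}.

Definition pref_frac (R : realType) (E : election) (a b : candidate E) : R :=
  #|voter E|%:R^-1 * \sum_(v : voter E) (prefers v a b)%:R.

(* Main.v *)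
(* Candidates are points of a product of m = 36 k^3 Condorcet cycles of length
   4k; a voter cares about one coordinate, so margins are averages of
   coordinatewise margins. In one cycle, the successor of a point b beats b and
   does almost as well as b against every other point. Hence against k points
   with weights q, the reply [successor of a point drawn from q] has expected
   margin at least about |q|_2^2 >= 1/k, because the margin of q against itself
   vanishes by antisymmetry. Choosing the coordinates of a one after the other,
   with weights given by the current deficits against the members of S, turns
   these averaged guarantees into a margin of order 1/k against all of S. *)
Require Import Defs.
From HB Require Import structures.
From mathcomp Require Import all_boot all_order all_algebra.
From mathcomp Require Import reals.
From mathcomp Require Import zify ring lra.
Set Implicit Arguments.
Unset Strict Implicit.
Unset Printing Implicit Defensive.
Import Order.TTheory GRing.Theory Num.Theory.
Local Open Scope ring_scope.

(** * Quadratic estimates and approachability *)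

Lemma sqr_sum_le (R : realFieldType) (J : finType) (q : J -> R) :
  (\sum_j q j) ^+ 2 <= #|J|%:R * \sum_j q j ^+ 2.
Proof.
set Q := \sum_j q j; set n : R := #|J|%:R.
have [n0|n_gt0] := posnP #|J|.
  by rewrite /n n0 mul0r /Q big1 ?expr0n // => j; have := card0_eq n0 j.
have n_pos : 0 < n by rewrite ltr0n.
have : 0 <= \sum_j (n * q j - Q) ^+ 2 by apply: sumr_ge0 => j _; exact: sqr_ge0.
have -> : \sum_j (n * q j - Q) ^+ 2 = n * (n * \sum_j q j ^+ 2 - Q ^+ 2).
  rewrite (eq_bigr (fun j => n ^+ 2 * q j ^+ 2 - 2 * n * Q * q j + Q ^+ 2)) => [|j _];
    last by ring.
  rewrite big_split sumrB -!mulr_sumr /= sumr_const -[_ *+ _]mulr_natr -/Q -/n.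
  ring.
by rewrite pmulr_rge0 // subr_ge0.
Qed.

(** The right side is the square of [max 0 x + y], and replacing [x] by its positive part can only
    increase [max 0 (x + y)]. *)
Lemma sqr_pos_part_add (R : realFieldType) (x y : R) :
  Num.max 0 (x + y) ^+ 2 <= Num.max 0 x ^+ 2 + 2 * Num.max 0 x * y + y ^+ 2.
Proof. by case: (leP 0 (x + y)) => ?; case: (leP 0 x) => ?; nra. Qed.

(* Blackwell's approachability argument: choosing each move against the weights
   [q j] = current deficit of [j], the sum of squared deficits grows by at most
   a constant per round. *)
Lemma approachability (R : realFieldType) (X J : finType) (x0 : X)
    (T : nat -> X -> J -> R) (B d : R) :
  (forall i x j, `|d - T i x j| <= B) ->
  (forall i (q : J -> R), (forall j, 0 <= q j) ->
     exists x, d * \sum_j q j <= \sum_j q j * T i x j) ->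
  forall m, exists a : nat -> X,
    \sum_j Num.max 0 (m%:R * d - \sum_(i < m) T i (a i) j) ^+ 2
      <= m%:R * #|J|%:R * B ^+ 2.
Proof.
move=> TB Tq; elim=> [|m [a IH]].
  exists (fun=> x0); rewrite !mul0r big1 // => j _.
  by rewrite big_ord0 subr0 maxxx expr0n.
pose D j := Num.max 0 (m%:R * d - \sum_(i < m) T i (a i) j).
have D_ge0 j : 0 <= D j by rewrite le_max lexx.
have [x Hx] := Tq m D D_ge0.
exists (fun i => if (i < m)%N then a i else x).
apply: (@le_trans _ _ (\sum_j (D j ^+ 2 + 2 * (D j * (d - T m x j)) + B ^+ 2))).
  apply: ler_sum => j _; rewrite big_ord_recr /= ltnn.
  under eq_bigr => i _ do rewrite ltn_ord.
  rewrite (_ : _ - _ = (m%:R * d - \sum_(i < m) T i (a i) j) + (d - T m x j)); last first.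
    by rewrite -natr1; ring.
  apply: le_trans (sqr_pos_part_add _ _) _; rewrite mulrA lerD2l.
  by rewrite -[leLHS]real_normK ?num_real // lerXn2r ?nnegrE ?(le_trans _ (TB m x j)).
rewrite !big_split /= sumr_const -mulr_sumr.
(* The cross term is nonpositive because [x] answers the weights [D]; the round adds only [B ^+ 2]
   per index. *)
have : \sum_j D j * (d - T m x j) <= 0.
  under eq_bigr => j _ do rewrite mulrBr.
  by rewrite sumrB -mulr_suml subr_le0 mulrC.
rewrite -[_ *+ _]mulr_natl -natr1; rewrite -/D in IH; nra.
Qed.

(** * Margins in one Condorcet cycle *)

Definition cmp (R : realFieldType) (r s : nat) : R := (s < r)%N%:R - (r < s)%N%:R.

Lemma cmp_anti (R : realFieldType) r s : cmp R r s = - cmp R s r.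
Proof. by rewrite /cmp opprB. Qed.

Lemma norm_cmp (R : realFieldType) r s : `|cmp R r s| <= 1.
Proof. by rewrite /cmp; case: ltngtP => _; rewrite ?subr0 ?sub0r ?normrN ?normr0 ?normr1. Qed.

Definition rot_rank N (v x : 'I_N) : nat := ((x + v) %% N)%N.

Lemma rot_rankC N (v x : 'I_N) : rot_rank v x = rot_rank x v.
Proof. by rewrite /rot_rank addnC. Qed.

Lemma rot_rank_inj N (v : 'I_N) : injective (rot_rank v).
Proof.
move=> x y /eqP; rewrite /rot_rank eqn_modDr !modn_small // => /eqP.
exact: val_inj.
Qed.

Lemma rot_rank_ordS N (v x : 'I_N) :
  rot_rank v (ordS x) = if rot_rank v x == N.-1 then 0%N else (rot_rank v x).+1.
Proof.
rewrite /rot_rank /= modnDml addSn -addn1 -modnDml addn1.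
have : ((x + v) %% N < N)%N by rewrite ltn_mod; case: N x v => [[]|].
move: (_ %% N)%N => r rN; case: eqP => [->|rN'].
  by rewrite prednK ?modnn //; lia.
by rewrite modn_small //; lia.
Qed.

(* [cyc_margin x y / N] is the margin of [x] over [y] in the Condorcet cycle on [N] candidates. *)
Definition cyc_margin (R : realFieldType) N (x y : 'I_N) : R :=
  \sum_v cmp R (rot_rank v x) (rot_rank v y).

Lemma cyc_margin_anti (R : realFieldType) N (x y : 'I_N) :
  cyc_margin R x y = - cyc_margin R y x.
Proof. by rewrite /cyc_margin -sumrN; apply: eq_bigr => v _; exact: cmp_anti. Qed.

Lemma norm_cyc_margin (R : realFieldType) N (x y : 'I_N) : `|cyc_margin R x y| <= N%:R.
Proof.
apply: le_trans (ler_norm_sum _ _ _) _.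
apply: le_trans (ler_sum _ (fun v _ => norm_cmp _ _ _)) _.
by rewrite sumr_const card_ord.
Qed.

(** The successor gains one rank with each voter, which never hurts and turns a tie into a win. The
    exception is a voter with [x] on top: there the rank wraps to 0, at a cost of at most 2. *)
Lemma cyc_margin_ordS (R : realFieldType) N (x y : 'I_N) :
  cyc_margin R x y + N%:R * (x == y)%:R - 2 <= cyc_margin R (ordS x) y.
Proof.
(* Ranks are symmetric in voter and candidate, hence also injective in the voter. *)
have top1 : \sum_(v < N) (rot_rank v x == N.-1)%:R <= 1 :> R.
  rewrite -natr_sum -[1]/(1%:R) ler_nat.
  rewrite -(big_mkcond (fun v : 'I_N => rot_rank v x == N.-1) (fun=> 1%N)) /= sum1dep_card.
  apply/card_le1_eqP => v w; rewrite !inE => /eqP vx /eqP wx.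
  by apply: (@rot_rank_inj _ x); rewrite ![rot_rank x _]rot_rankC vx wx.
suff : cyc_margin R x y + \sum_(v < N) (x == y)%:R
         - 2 * \sum_(v < N) (rot_rank v x == N.-1)%:R <= cyc_margin R (ordS x) y.
  rewrite sumr_const card_ord -mulr_natl; lra.
rewrite mulr_sumr -big_split -sumrB /=; apply: ler_sum => v _.
rewrite rot_rank_ordS -(inj_eq (@rot_rank_inj _ v)).
have ltN z : (rot_rank v z < N)%N by rewrite ltn_mod; case: (N) z => [[]|].
have := ltN x; have := ltN y.
move: (rot_rank v x) (rot_rank v y) => r s sN rN; rewrite /cmp.
case: (r =P N.-1) => [rE|rE].
  rewrite ltn0; case: (ltngtP s r) => h; case: (ltnP 0 s) => h' /=; try lra.
case: (ltngtP s r) => h.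
- have -> : (s < r.+1)%N by lia.
  have -> : (r.+1 < s)%N = false by lia.
  by rewrite /=; lra.
- have -> : (s < r.+1)%N = false by lia.
  by case: (r.+1 < s)%N => /=; lra.
- rewrite h ltnSn; have -> : (r.+1 < r)%N = false by lia.
  by rewrite /=; lra.
Qed.

(* Averaging the replies [ordS (s j)] with the weights [q] itself, the
   antisymmetric part of the margin cancels. *)
Lemma cyc_margin_reply (R : realFieldType) (J : finType) N (s : J -> 'I_N) (q : J -> R) :
  (0 < #|J|)%N -> N = (4 * #|J|)%N -> (forall j, 0 <= q j) ->
  exists x, 2 * \sum_j q j <= \sum_j q j * cyc_margin R x (s j).
Proof.
move=> J_gt0 NE q_ge0; have /card_gt0P [j0 _] := J_gt0.
set Q := \sum_j q j.
pose h l := \sum_j q j * cyc_margin R (ordS (s l)) (s j) - 2 * Q.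
suff [l Hl] : exists l, 0 <= h l by exists (ordS (s l)); rewrite -subr_ge0.
apply/existsP; apply: contraT; rewrite negb_exists => /forallP h_lt0.
have {}h_lt0 l : h l < 0 by rewrite ltNge h_lt0.
have qh_le0 l : q l * h l <= 0 by rewrite mulr_ge0_le0 // ltW.
(* The sum is at least [N * \sum_l q l ^+ 2 - 4 * Q ^+ 2]: half of the loss comes from the
   wraparound, half from the target [2 * Q]. Cauchy-Schwarz with [N = 4 * #|J|] covers both. *)
have qh_ge0 : 0 <= \sum_l q l * h l.
  have anti0 : \sum_l \sum_j q l * (q j * cyc_margin R (s l) (s j)) = 0.
    set A := LHS; suff : A = - A by lra.
    rewrite {1}/A exchange_big /= -sumrN; apply: eq_bigr => l _.
    rewrite -sumrN; apply: eq_bigr => j _; rewrite cyc_margin_anti; ring.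
  have diag : \sum_l N%:R * q l ^+ 2 <=
      \sum_l \sum_j q l * (q j * (N%:R * (s l == s j)%:R)).
    apply: ler_sum => l _; rewrite (bigD1 l) //= eqxx mulr1.
    rewrite -[leLHS]addr0 lerD //; first by rewrite le_eqVlt; apply/orP; left; apply/eqP; ring.
    by apply: sumr_ge0 => j _; rewrite !mulr_ge0.
  have QQ : \sum_l \sum_j q l * (q j * 2) = 2 * Q ^+ 2.
    under eq_bigr => l _ do rewrite -mulr_sumr -mulr_suml.
    by rewrite -mulr_suml -/Q; ring.
  have low : \sum_l \sum_j q l * (q j * cyc_margin R (s l) (s j))
      + \sum_l \sum_j q l * (q j * (N%:R * (s l == s j)%:R))
      - \sum_l \sum_j q l * (q j * 2)
      <= \sum_l \sum_j q l * (q j * cyc_margin R (ordS (s l)) (s j)).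
    rewrite -big_split -sumrB /=; apply: ler_sum => l _.
    rewrite -big_split -sumrB /=; apply: ler_sum => j _.
    rewrite -!mulrDr -!mulrBr; do 2 apply: ler_wpM2l => //.
    exact: cyc_margin_ordS.
  have hE : \sum_l q l * h l =
      \sum_l \sum_j q l * (q j * cyc_margin R (ordS (s l)) (s j)) - 2 * Q ^+ 2.
    under eq_bigr => l _ do rewrite mulrBr mulr_sumr.
    by rewrite sumrB -mulr_suml -/Q; congr (_ - _); ring.
  have CS := sqr_sum_le q.
  have NR : N%:R = 4 * #|J|%:R :> R by rewrite NE natrM.
  rewrite -mulr_sumr {1}NR in diag; rewrite -/Q in CS.
  rewrite hE; lra.
(* Since every [h l] is negative, a vanishing sum forces [q = 0], and then [h j0 = 0], a
   contradiction. *)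
have qh0 : \sum_l q l * h l = 0 by apply/le_anti; rewrite qh_ge0 andbT sumr_le0.
have q0 l : q l = 0.
  have /eqP : \sum_l - (q l * h l) = 0 by rewrite sumrN qh0 oppr0.
  rewrite psumr_eq0 => [/allP/(_ l)|i _]; last by rewrite oppr_ge0.
  rewrite mem_index_enum oppr_eq0 mulf_eq0 (lt_eqF (h_lt0 l)) orbF.
  by move=> /(_ isT)/eqP.
have := h_lt0 j0; rewrite /h /Q !big1 ?mulr0 ?subr0 ?ltxx // => j _.
by rewrite q0 mul0r.
Qed.

(** * The election on a product of cycles *)

Lemma lex_ltn K r s (x y : 'I_K) :
  (r * K + x < s * K + y)%N = (r < s)%N || (r == s) && (x < y)%N.
Proof.
have := ltn_ord x; have := ltn_ord y.
by case: (ltngtP r s) => [h|h|->] /=; [nia | nia | rewrite ltn_add2l].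
Qed.

Section CyclicProduct.
Variables m N : nat.
Let C := {ffun 'I_m -> 'I_N}.
Let V := ('I_m * 'I_N * bool)%type.

Definition tie_rank (t : bool) (a : C) : 'I_#|C| :=
  if t then enum_rank a else rev_ord (enum_rank a).

(* Voter [(i, v, t)] compares the [v]-rotated [i]th coordinates, breaking ties
   by an arbitrary order on candidates, reversed when [t] is false so that ties
   contribute nothing to margins. *)
Definition cyc_key (u : V) (a : C) : nat :=
  (rot_rank u.1.2 (a u.1.1) * #|C| + tie_rank u.2 a)%N.

Lemma tie_rank_inj t : injective (tie_rank t).
Proof. by case: t => a b /= => [|/rev_ord_inj]; exact: enum_rank_inj. Qed.

Lemma tie_rank_neg a b : a != b ->
  (tie_rank true b < tie_rank true a)%N = ~~ (tie_rank false b < tie_rank false a)%N.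
Proof.
rewrite -(inj_eq (@tie_rank_inj true)) -val_eqE /tie_rank /=.
move: (enum_rank a) (enum_rank b) => [x xK] [y yK] /=; move: xK yK.
move: #|_| => K; lia.
Qed.

Definition cyc_prefers (u : V) : rel C := fun a b => (cyc_key u b < cyc_key u a)%N.

Lemma cyc_prefers_irr u : irreflexive (cyc_prefers u).
Proof. by move=> a; exact: ltnn. Qed.

Lemma cyc_prefers_trans u : transitive (cyc_prefers u).
Proof. by move=> b a c ab bc; exact: ltn_trans bc ab. Qed.

Lemma cyc_prefers_total u a b : a != b -> cyc_prefers u a b || cyc_prefers u b a.
Proof.
rewrite -(inj_eq (@tie_rank_inj u.2)) -val_eqE /cyc_prefers /cyc_key /= !lex_ltn.
by case: ltngtP => //= _; case: ltngtP.
Qed.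

Lemma cyc_prefers_pair (R : realFieldType) i v (a b : C) : a != b ->
  (cyc_prefers (i, v, true) a b)%:R + (cyc_prefers (i, v, false) a b)%:R
    = 1 + cmp R (rot_rank v (a i)) (rot_rank v (b i)).
Proof.
move=> ab; rewrite /cyc_prefers /cyc_key !lex_ltn (tie_rank_neg ab) /= /cmp.
by case: ltngtP => _ /=; [| |case: ltnP => _ /=]; lra.
Qed.

Definition cyc_election (m_gt0 : (0 < m)%N) (N_gt0 : (0 < N)%N) : election.
Proof.
apply: (@Election V C cyc_prefers) cyc_prefers_irr cyc_prefers_trans cyc_prefers_total.
- by rewrite !card_prod !card_ord card_bool !muln_gt0 m_gt0 N_gt0.
- by rewrite card_ffun !card_ord expn_gt0 N_gt0.
Defined.

Lemma pref_frac_cyc_election (R : realType) m_gt0 N_gt0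
    (a b : candidate (cyc_election m_gt0 N_gt0)) : a != b ->
  pref_frac R a b = 1 / 2 + (2 * m%:R * N%:R)^-1 * \sum_(i < m) cyc_margin R (a i) (b i).
Proof.
move=> ab; rewrite /pref_frac /= !card_prod !card_ord card_bool !natrM.
rewrite -(pair_big xpredT xpredT (fun p t => (cyc_prefers (p, t) a b)%:R)) /=.
under eq_bigr => p _ do rewrite big_bool.
rewrite -(pair_big xpredT xpredT (fun i v => (cyc_prefers (i, v, true) a b)%:R
   + (cyc_prefers (i, v, false) a b)%:R)) /=.
under eq_bigr => i _ do under eq_bigr => v _ do rewrite cyc_prefers_pair //.
under eq_bigr => i _ do rewrite big_split /= sumr_const card_ord.
rewrite big_split /= sumr_const card_ord -mulrnA -mulr_natr natrM mul1r.
have m0 : m%:R != 0 :> R by rewrite pnatr_eq0 -lt0n.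
have N0 : N%:R != 0 :> R by rewrite pnatr_eq0 -lt0n.
rewrite -/(cyc_margin _ _ _); field.
by rewrite m0 N0.
Qed.

End CyclicProduct.

Theorem theorem2 (R : realType) :
  exists c : R, 0 < c /\
    forall k : nat, (1 <= k)%N ->
      exists E : election, (k <= #|candidate E|)%N /\
        forall S : {set candidate E}, #|S| = k ->
          exists a : candidate E, a \notin S /\
            forall b : candidate E, b \in S ->
              1 / 2 + c / k%:R <= pref_frac R a b.
Proof.
(* A total margin of [m] among [2 * m * N = 8 * m * k] voters gives [1 / (8 * k)]. *)
exists (1 / 8); split=> [|k k_gt0]; first by lra.
pose N := (4 * k)%N; pose m := (36 * k ^ 3)%N.
have N_gt0 : (0 < N)%N by rewrite muln_gt0.
have m_gt0 : (0 < m)%N by rewrite muln_gt0 expn_gt0 k_gt0.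
exists (cyc_election m_gt0 N_gt0); split=> [|S Sk].
  rewrite /= card_ffun !card_ord; apply: leq_trans (leq_trans (ltnW (ltn_expl m _)) _).
  - by rewrite /m; nia.
  - exact: (isT : 1 < 2)%N.
  - by rewrite leq_exp2r // /N; lia.
pose J : finType := {b : candidate (cyc_election m_gt0 N_gt0) | b \in S}.
have Jk : #|J| = k by rewrite card_sig.
have k_pos : 1 <= k%:R :> R by rewrite ler1n.
(* Rounds are indexed by [nat]; from [m] on, coordinate 0 serves as a dummy. *)
pose coord (b : {ffun 'I_m -> 'I_N}) (i : nat) := b (insubd (Ordinal m_gt0) i).
have coordE b (i : 'I_m) : coord b i = b i.
  by rewrite /coord; congr (b _); apply: val_inj; rewrite val_insubd ltn_ord.
(* The bound [6 * k] covers [N + 2 = 4 * k + 2], as [k >= 1]. *)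
have [i x j|i q q_ge0|a Ha] := @approachability R _ J (Ordinal N_gt0)
    (fun i x j => cyc_margin R x (coord (val j) i)) (6 * k%:R) 2 _ _ m.
- apply: le_trans (ler_normB _ _) _.
  have := norm_cyc_margin R x (coord (val j) i).
  by rewrite normr_nat /N natrM; lra.
- by apply: cyc_margin_reply q_ge0; rewrite Jk.
pose a' : candidate (cyc_election m_gt0 N_gt0) := [ffun i : 'I_m => a i].
have margin b : b \in S -> m%:R <= \sum_(i < m) cyc_margin R (a' i) (b i).
  move=> bS; set G := \sum_(i < m) _.
  (* One squared deficit is at most the whole sum, and [m = 36 * k ^ 3] makes its bound exactly
     [m ^ 2]; so half of the target [2 * m] survives. *)
  have : Num.max 0 (m%:R * 2 - G) ^+ 2 <= m%:R ^+ 2.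
    apply: (@le_trans _ _ (m%:R * k%:R * (6 * k%:R) ^+ 2)); last first.
      by rewrite /m natrM natrX le_eqVlt; apply/orP; left; apply/eqP; ring.
    rewrite Jk in Ha; apply: le_trans Ha; rewrite (bigD1 (exist _ b bS : J)) //=.
    rewrite (eq_bigr (fun i : 'I_m => cyc_margin R (a' i) (b i))) => [|i _].
      by rewrite lerDl sumr_ge0 // => j _; exact: sqr_ge0.
    by rewrite coordE ffunE.
  rewrite ler_sqr ?nnegrE ?le_max ?lexx // ge_max => /andP[_]; lra.
have m_pos : 0 < m%:R :> R by rewrite ltr0n.
(* The margin of [a'] against itself is 0, below [m]. *)
have a'S : a' \notin S.
  apply/negP => /margin; rewrite big1 => [|i _]; first by rewrite leNgt m_pos.
  by have := cyc_margin_anti R (a' i) (a' i); lra.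
exists a'; split=> // b bS.
rewrite pref_frac_cyc_election; last by apply: contraNneq a'S => ->.
rewrite lerD2l; apply: (@le_trans _ _ ((2 * m%:R * N%:R)^-1 * m%:R)); last first.
  by apply: ler_wpM2l (margin b bS); rewrite invr_ge0 !mulr_ge0.
rewrite /N natrM le_eqVlt; apply/orP; left; apply/eqP; field.
by rewrite !gt_eqF // ltr0n.
Qed.
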